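(* Every cw-expansive homeomorphism $f\colon X\to X$ of a Peano continuum $(X,d)$ admits a self-similar hyperbolic cw-metric $D\colon E\to\mathbb{R}$.
   Context: A Peano continuum is a compact, connected, locally connected metric space. A continuum is a compact connected set; $\mathcal{C}(X)$ is the set of all non-empty subcontinua of $X$ (singletons included). $W^s_c(x)=\{y: d(f^n(x),f^n(y))\le c\ \forall n\ge 0\}$ and $W^u_c(x)=\{y: d(f^{-n}(x),f^{-n}(y))\le c\ \forall n\ge 0\}$. $f$ is cw-expansive if there is $c>0$ such that $W^s_c(x)\cap W^u_c(x)$ is totally disconnected for every $x\in X$. Let $E=\{(p,q,C): C\in\mathcal{C}(X),\ p,q\in C\}$; write $C_{(p,q)}=(p,q,C)$ and $f(C_{(p,q)})=f(C)_{(f(p),f(q))}$. For $r>0$ let $\mathcal{C}^s_r(X)=\{C\in\mathcal{C}(X):\operatorname{diam} f^n(C)\le r\ \forall n\ge0\}$ and $\mathcal{C}^u_r(X)=\{C\in\mathcal{C}(X):\operatorname{diam} f^{-n}(C)\le r\ \forall n\ge0\}$. A hyperbolic cw-metric for $f$ is a function $D\colon E\to\mathbb{R}$ such that: (1) $D(C_{(p,q)})\ge0$ with equality iff $C$ is a singleton; $D(C_{(p,q)})=D(C_{(q,p)})$; $D([A\cup B]_{(a,c)})\le D(A_{(a,b)})+D(B_{(b,c)})$ for $a\in A$, $b\in A\cap B$, $c\in B$. (2) There are $\mu\in(0,1)$ and $\varepsilon_0>0$ such that $D(f^n(C_{(p,q)}))\le4\mu^nD(C_{(p,q)})$ for all $n\ge0$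 if $C\in\mathcal{C}^s_{\varepsilon_0}(X)$, and $D(f^{-n}(C_{(p,q)}))\le4\mu^nD(C_{(p,q)})$ for all $n\ge0$ if $C\in\mathcal{C}^u_{\varepsilon_0}(X)$. (3) For each $\theta>0$ there is $\gamma>0$ such that $\operatorname{diam}(C)<\gamma$ implies $D(C_{(p,q)})<\theta$ for all $p,q\in C$, and $D(C_{(p,q)})<\gamma$ for some $p,q\in C$ implies $\operatorname{diam}(C)<\theta$. $D$ is self-similar if there exist $\xi>0$ and $\lambda>1$ such that, whenever $D(C_{(p,q)})\le\xi$, one has $\max\{D(f(C_{(p,q)})),D(f^{-1}(C_{(p,q)}))\}=\lambda D(C_{(p,q)})$. *)

(* Defs.v *)
From mathcomp Require Import all_boot all_order all_algebra.
From mathcomp Require Import all_classical all_reals all_analysis.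

Set Implicit Arguments.
Unset Strict Implicit.
Unset Printing Implicit Defensive.

Import Order.TTheory GRing.Theory Num.Theory.

Local Open Scope classical_set_scope.
Local Open Scope ring_scope.

Definition locally_connected (X : topologicalType) :=
  forall (x : X) (U : set X), nbhs x U ->
    exists V : set X, [/\ open V, V x, connected V & V `<=` U].

Definition peano_continuum (R : realType) (X : metricType R) :=
  [/\ compact [set: X], connected [set: X] & locally_connected X].

(* [g] is the inverse [f^-1]; it is determined by [f]. *)
Definition homeomorphism (X : topologicalType) (f g : X -> X) :=
  [/\ continuous f, continuous g, cancel f g & cancel g f].

(* [sup] is [0] on sets that are empty or unbounded above; in a compact space
   the second case does not occur. *)
Definition diam (R : realType) (X : metricType R) (C : set X) : R :=
  sup [set mdist z.1 z.2 | z in C `*` C].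

Definition subcontinuum (X : topologicalType) (C : set X) :=
  [/\ C !=set0, compact C & connected C].

(* [Wloc f c x] is W^s_c(x) for [f]; W^u_c(x) for [f] is [Wloc f^-1 c x]. *)
Definition Wloc (R : realType) (X : metricType R) (f : X -> X) (c : R) (x : X)
    : set X :=
  [set y | forall n : nat, mdist (iter n f x) (iter n f y) <= c].

Definition cw_expansive (R : realType) (X : metricType R) (f g : X -> X) :=
  exists2 c : R, 0 < c &
    forall x : X, totally_disconnected (Wloc f c x `&` Wloc g c x).

(* The triple [(p, q, C)] is C_(p,q). *)
Definition E_set (X : topologicalType) : set (X * X * set X) :=
  [set t | [/\ subcontinuum t.2, t.2 t.1.1 & t.2 t.1.2]].

Definition E_map (X : Type) (f : X -> X) (t : X * X * set X)
    : X * X * set X :=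
  (f t.1.1, f t.1.2, f @` t.2).

(* [Cstable f r] is C^s_r(X) for [f]; C^u_r(X) for [f] is [Cstable f^-1 r]. *)
Definition Cstable (R : realType) (X : metricType R) (f : X -> X) (r : R)
    : set (set X) :=
  [set C | subcontinuum C /\ forall n : nat, diam (iter n f @` C) <= r].

(* A function on [E_set X] is represented by a function on all triples, whose
   values outside [E_set X] are irrelevant. *)

Definition cw_metric_axioms (R : realType) (X : metricType R)
    (D : X * X * set X -> R) :=
  [/\ forall p q C, E_set (p, q, C) ->
        0 <= D (p, q, C) /\ (D (p, q, C) = 0 <-> exists x, C = [set x]),
      forall p q C, E_set (p, q, C) -> D (p, q, C) = D (q, p, C)
    & forall (A B : set X) a b c, subcontinuum A -> subcontinuum B ->
        A a -> (A `&` B) b -> B c ->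
        D (a, c, A `|` B) <= D (a, b, A) + D (b, c, B)].

Definition cw_metric_hyperbolic (R : realType) (X : metricType R)
    (f g : X -> X) (D : X * X * set X -> R) :=
  exists mu eps0 : R, [/\ 0 < mu < 1, 0 < eps0,
    forall p q C, E_set (p, q, C) -> Cstable f eps0 C -> forall n : nat,
      D (E_map (iter n f) (p, q, C)) <= 4 * mu ^+ n * D (p, q, C)
  & forall p q C, E_set (p, q, C) -> Cstable g eps0 C -> forall n : nat,
      D (E_map (iter n g) (p, q, C)) <= 4 * mu ^+ n * D (p, q, C)].

Definition cw_metric_compatible (R : realType) (X : metricType R)
    (D : X * X * set X -> R) :=
  forall theta : R, 0 < theta -> exists2 gamma : R, 0 < gamma &
    forall C : set X, subcontinuum C ->
      (diam C < gamma -> forall p q, C p -> C q -> D (p, q, C) < theta) /\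
      ((exists p q, [/\ C p, C q & D (p, q, C) < gamma]) -> diam C < theta).

Definition hyperbolic_cw_metric (R : realType) (X : metricType R)
    (f g : X -> X) (D : X * X * set X -> R) :=
  [/\ cw_metric_axioms D, cw_metric_hyperbolic f g D & cw_metric_compatible D].

Definition self_similar (R : realType) (X : metricType R) (f g : X -> X)
    (D : X * X * set X -> R) :=
  exists xi lambda : R, [/\ 0 < xi, 1 < lambda &
    forall p q C, E_set (p, q, C) -> D (p, q, C) <= xi ->
      Num.max (D (E_map f (p, q, C))) (D (E_map g (p, q, C)))
        = lambda * D (p, q, C)].

(* Main.v *)
Require Import Defs.
From mathcomp Require Import all_boot all_order all_algebra.
From mathcomp Require Import all_classical all_reals all_analysis.
From mathcomp Require Import ring lra.

(* Let [T true = f], [T false = g], let [act T w] be the composition along a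
   word [w] of booleans, and let [rho C] be the supremum of [theta ^+ size w]
   over the words [w] for which [act T w @` C] has diameter above the
   expansivity constant. A compactness argument (limits of continua along an
   ultrafilter) makes cw-expansivity uniform, so that for [theta] close to 1 a
   union of three consecutively intersecting continua has [rho] at most twice
   the maximum. Frink's metrization lemma then gives a subadditive
   [chain_dist], the infimum of the sums of [rho] over the chains from [p] to
   [q] with union [C], and [rho / 2 <= chain_dist <= rho].

   With [theta = mu ^+ 2], put
   [cw_dist t = sup_w mu ^+ size w * chain_dist (act T w t)]. Taking images
   under [f] and [g] drops the empty word from the supremum and divides by
   [mu]; on small continua the empty word is irrelevant, because [chain_dist]
   expands at rate about [mu ^- 2]. Hence the self-similarity. It implies the
   hyperbolicity: along the orbit of a stable continuum, a step that fails to
   contract by [mu] starts an exponential growth, which is impossible. *)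

Set Implicit Arguments.
Unset Strict Implicit.
Unset Printing Implicit Defensive.

Import Order.TTheory GRing.Theory Num.Theory.
Import numFieldNormedType.Exports.

Local Open Scope classical_set_scope.
Local Open Scope ring_scope.

(** * Compactness: limits along an ultrafilter and uniform cw-expansivity *)

Section CompactMetric.
Variables (R : realType) (X : metricType R).
Hypothesis compactX : compact [set: X].

Lemma near_mdist_lt T (F : set_system T) {FF : Filter F} (h : T -> X) p
    (e : R) :
  h @ F --> p -> 0 < e -> \forall t \near F, mdist p (h t) < e.
Proof. by move=> /metricType_numDomainType.cvgr_dist_lt; apply. Qed.

(** Refine the filter of cofinite sets to an ultrafilter: by compactness the image of [F] under any
    sequence has a cluster point, and an ultrafilter converges to its cluster points. A single [F]
    serves all sequences, so no subsequences have to be extracted. *)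
Lemma compact_ultra_sequences : exists F : set_system nat,
  [/\ UltraFilter F, forall n, \forall m \near F, (n <= m)%N
    & forall x : nat -> X, exists p : X, x @ F --> p].
Proof.
have [F [ultraF ooF]] := ultraFilterLemma (eventually_filter).
exists F; split=> [//|n|x]; first by apply: ooF; exists n.
have FF : ProperFilter F by exact: ultra_proper.
have [|p [_ cp]] := compactX (F := x @ F); first exact: filterT.
exists p => V Vp.
have [//|FnV] := in_ultra_setVsetC (x @^-1` V) ultraF.
have [y []] := cp (~` V) V FnV Vp.
by move=> /[apply].
Qed.

(** Boundedness makes [diam] a genuine supremum on non-empty sets, instead of the default value 0 of
    [sup]. *)
Lemma compact_mdist_bounded : exists M : R, forall x y : X, mdist x y <= M.
Proof.
have [F [ultraF Foo Fcvg]] := compact_ultra_sequences.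
have FF : ProperFilter F by exact: ultra_proper.
apply: contrapT => unbdd.
have far n : exists z : X * X, n%:R < mdist z.1 z.2.
  apply: contrapT => /forallNP near_; apply: unbdd; exists n%:R => x y.
  by rewrite leNgt; apply/negP => ltxy; apply: (near_ (x, y)).
have [z far_z] := choice far.
have [p cvgp] := Fcvg (fst \o z); have [q cvgq] := Fcvg (snd \o z).
have [n [[ltp ltq] ltn]] : exists n,
    (mdist p (z n).1 < 1 /\ mdist q (z n).2 < 1) /\
    (Num.truncn (mdist p q + 2) < n)%N.
  apply: (@filter_ex _ F); apply: filterI; last exact: Foo.
  apply: filterI; first exact: near_mdist_lt cvgp ltr01.
  exact: near_mdist_lt cvgq ltr01.
have := far_z n; rewrite ltNge => /negP; apply.
have := metric_triangle (z n).1 p (z n).2.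
have := metric_triangle p q (z n).2.
rewrite (metric_sym _ p).
have : mdist p q + 2 < n%:R by rewrite -truncn_lt_nat// addr_ge0// mdist_ge0.
by lra.
Qed.

Lemma compact_continuous_uniform (h : X -> X) (e : R) : continuous h -> 0 < e ->
  exists2 d : R, 0 < d & forall x y, mdist x y < d -> mdist (h x) (h y) < e.
Proof.
move=> ch e0; have [F [ultraF Foo Fcvg]] := compact_ultra_sequences.
have FF : ProperFilter F by exact: ultra_proper.
apply: contrapT => nuc.
have bad (n : nat) : exists z : X * X,
    mdist z.1 z.2 < n.+1%:R^-1 /\ e <= mdist (h z.1) (h z.2).
  apply: contrapT => /forallNP good; apply: nuc; exists n.+1%:R^-1 => // x y xy.
  by rewrite ltNge; apply/negP => exy; apply: (good (x, y)).
have [z bad_z] := choice bad.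
have [p cvgp] := Fcvg (fst \o z).
have cvgq : (snd \o z) @ F --> p.
  apply/metricType_numDomainType.cvgrPdist_lt => d d0.
  have d20 : 0 < d / 2 by rewrite divr_gt0.
  have Fp : \forall n \near F, mdist p (z n).1 < d / 2.
    exact: near_mdist_lt cvgp d20.
  near=> n.
  apply: le_lt_trans (metric_triangle _ (z n).1 _) _.
  rewrite [ltRHS](splitr d) ltrD//; first by near: n; exact: Fp.
  have [+ _] := bad_z n; move/lt_trans; apply.
  rewrite invf_plt ?posrE ?divr_gt0//.
  have : (Num.truncn (d / 2)^-1 <= n)%N by near: n; exact: Foo.
  move=> len; apply: (lt_le_trans (truncnS_gt _)).
  by rewrite ler_nat ltnS.
have e20 : 0 < e / 2 by rewrite divr_gt0.
have hp : \forall n \near F, mdist (h p) (h (z n).1) < e / 2.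
  exact: near_mdist_lt (cvg_comp _ _ cvgp (ch p)) e20.
have hq : \forall n \near F, mdist (h p) (h (z n).2) < e / 2.
  exact: near_mdist_lt (cvg_comp _ _ cvgq (ch p)) e20.
have [n [/= lp lq]] := filter_ex (filterI hp hq).
have [_] := bad_z n.
have := metric_triangle (h (z n).1) (h p) (h (z n).2).
by rewrite (metric_sym _ (h p)); lra.
Unshelve. all: by end_near. Qed.

(** If the limit set split into two separated parts, these would be closed, hence contained in
    disjoint open sets [U] and [V]. Some [C n] would then meet both and lie in their union, against
    connectedness. *)
Lemma sub_ultra_limit_connected (F : set_system nat) (C : nat -> set X) :
    UltraFilter F -> (forall x : nat -> X, exists p : X, x @ F --> p) ->
    (forall n, connected (C n)) ->
  connected [set y | forall V, nbhs y V -> \forall n \near F, C n `&` V !=set0].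
Proof.
move=> ultraF Fcvg Cconn; set L := (X in connected X).
have FF : ProperFilter F by exact: ultra_proper.
have closedL : closed L.
  move=> y clLy V /nbhs_interior Vy.
  by have [z [Lz Vz]] := clLy _ Vy; apply: Lz.
apply/connectedP => E [E0 LE [sep0 sep1]].
have closedE b : closed (E b).
  have clL : closure (E b) `<=` L.
    apply: (subset_trans _ closedL); apply: closureS; rewrite LE.
    by case: b => x; [right|left].
  move=> y cly; have := clL y cly; rewrite LE.
  case: b cly {clL} => cly [] // Ey.
    by suff : set0 y by []; rewrite -sep1.
  by suff : set0 y by []; rewrite -sep0.
have disjE : E false `&` E true = set0.
  by apply: separated_disjoint.
have [U [V [oU oV EU EV UV]]] := (@normal_openP R X).1
  (compact_normal (@metric_hausdorff R X) compactX) _ _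
  (closedE false) (closedE true) disjE.
have EL b : E b `<=` L by rewrite LE; case: b => x; [right|left].
have [a Ea] := E0 false; have [b Eb] := E0 true.
have hitU : \forall n \near F, C n `&` U !=set0.
  by apply: (EL false a Ea); apply: open_nbhs_nbhs; split=> //; exact: EU.
have hitV : \forall n \near F, C n `&` V !=set0.
  by apply: (EL true b Eb); apply: open_nbhs_nbhs; split=> //; exact: EV.
(* Otherwise pick points of [C n] outside the union (the value [a] is a dummy for the other
   indices). Their limit lies in [L], hence in the open union, which then contains some of the
   picked points. *)
have CUV : \forall n \near F, C n `<=` U `|` V.
  have [//|esc] := in_ultra_setVsetC [set n | C n `<=` U `|` V] ultraF.
  have /choice[z escz] n : exists z,
      ~ (C n `<=` U `|` V) -> C n z /\ ~ (U `|` V) z.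
    have [sub|/existsNP[z /not_implyP[Cz nz]]] := pselect (C n `<=` U `|` V).
      by exists a.
    by exists z.
  have [q zq] := Fcvg z.
  have Lq : L q.
    move=> W /zq FW; near=> n; exists (z n); split.
      by have [] : C n (z n) /\ ~ (U `|` V) (z n) by apply: escz; near: n.
    by near: n.
  have oUV : open (U `|` V) by exact: openU.
  have nUVq : nbhs q (U `|` V).
    apply: open_nbhs_nbhs; split=> //; move: Lq; rewrite LE.
    by case=> ?; [left; exact: EU|right; exact: EV].
  have zUV : \forall n \near F, (U `|` V) (z n) := zq _ nUVq.
  have [n [/escz[_ +] +]] := filter_ex (filterI esc zUV).
  by [].
have [n [[[x [Cx Ux]] [y [Cy Vy]]] CnUV]] :=
  filter_ex (filterI (filterI hitU hitV) CUV).
have UVsep : separated U V.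
  split; rewrite -subset0 => t [].
    by move=> clUt Vt; have := clUt V; rewrite UV; case=> //;
      exact: open_nbhs_nbhs.
  by move=> Ut clVt; have := clVt U; rewrite setIC UV; case=> //;
    exact: open_nbhs_nbhs.
suff : set0 x by [].
have [CU|CV] := connected_subset UVsep CnUV (Cconn n).
  by suff : set0 y by []; rewrite -UV; split=> //; exact: CU.
by rewrite -UV; split=> //; exact: CV.
Unshelve. all: by end_near. Qed.

Lemma mdist_le_diam (C : set X) x y : C x -> C y -> mdist x y <= diam C.
Proof.
move=> Cx Cy; have [M leM] := compact_mdist_bounded.
apply: ub_le_sup; first by exists M => _ [z _ <-].
by exists (x, y).
Qed.

Lemma diam_le (C : set X) (e : R) : 0 <= e ->
  (forall x y, C x -> C y -> mdist x y <= e) -> diam C <= e.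
Proof.
move=> e0 leC; rewrite /diam; set D := (X in sup X).
have [->|/set0P D0] := eqVneq D set0; first by rewrite sup0.
by apply: ge_sup => // _ [[x y] [Cx Cy] <-]; exact: leC.
Qed.

Lemma continuous_iter (h : X -> X) n : continuous h -> continuous (iter n h).
Proof.
move=> ch; elim: n => [|n IHn] x /=; first exact: cvg_id.
by apply: (@continuous_comp _ _ _ (iter n h) h); [exact: IHn|exact: ch].
Qed.

Lemma subcontinuum_image (h : X -> X) (C : set X) :
  continuous h -> subcontinuum C -> subcontinuum (h @` C).
Proof.
move=> ch [[x Cx] cC conC]; split; first by exists (h x), x.
- by apply: continuous_compact => //; exact: continuous_subspaceT.
- by apply: connected_continuous_connected => //; exact: continuous_subspaceT.
Qed.

(** For a fixed time [n] the diameter bound is available only for [m >= n], which is enough because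
    [F] contains every tail; continuity of [iter n h] passes the bound to the limit. *)
Lemma ultra_limit_Wloc (F : set_system nat) (C : nat -> set X) (h : X -> X)
    (c : R) (z : nat -> X) (p y : X) :
  ProperFilter F -> (forall n, \forall m \near F, (n <= m)%N) -> continuous h ->
  (forall m, C m (z m)) ->
  (forall m n, (n <= m)%N -> diam (iter n h @` C m) <= c) ->
  z @ F --> p -> (forall V, nbhs y V -> \forall n \near F, C n `&` V !=set0) ->
  Wloc h c p y.
Proof.
move=> FF Foo ch Cz diamC zp Ly n; rewrite leNgt; apply/negP => far.
pose e := mdist (iter n h p) (iter n h y) - c.
have e0 : 0 < e by rewrite subr_gt0.
have e20 : 0 < e / 2 by rewrite divr_gt0.
have cn := continuous_iter ch (n := n).
have Fz : \forall m \near F, mdist (iter n h p) (iter n h (z m)) < e / 2.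
  exact: near_mdist_lt (cvg_comp _ _ zp (cn p)) e20.
have Fy : \forall m \near F,
    C m `&` [set x | mdist (iter n h y) (iter n h x) < e / 2] !=set0.
  by apply: Ly; exact: near_mdist_lt (cn y) e20.
have [m [[ltz [x [Cx /= ltx]]] lenm]] :=
  filter_ex (filterI (filterI Fz Fy) (Foo n)).
have : mdist (iter n h (z m)) (iter n h x) <= c.
  apply: le_trans (diamC _ _ lenm).
  by apply: mdist_le_diam; [exists (z m)|exists x].
have := metric_triangle (iter n h p) (iter n h (z m)) (iter n h y).
have := metric_triangle (iter n h (z m)) (iter n h x) (iter n h y).
rewrite metric_sym in ltx.
by move: far ltz ltx; rewrite /e; lra.
Qed.

(** A sequence of counterexamples [C m], each with two points more than [d] apart, has a connected
    limit set lying in both local sets of a limit point [p]. Total disconnectedness reduces it to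
    [p], so the two points become arbitrarily close. *)
Lemma cw_expansive_uniform (f g : X -> X) (c d : R) :
    continuous f -> continuous g ->
    (forall x, totally_disconnected (Wloc f c x `&` Wloc g c x)) -> 0 < d ->
  exists m, forall C, connected C ->
    (forall n, (n <= m)%N ->
      diam (iter n f @` C) <= c /\ diam (iter n g @` C) <= c) ->
    diam C <= d.
Proof.
move=> cf cg totd d0; have [F [ultraF Foo Fcvg]] := compact_ultra_sequences.
have FF : ProperFilter F by exact: ultra_proper.
apply: contrapT => /forallNP noM.
have /choice[C badC] m : exists C : set X, [/\ connected C,
    forall n, (n <= m)%N -> diam (iter n f @` C) <= c,
    forall n, (n <= m)%N -> diam (iter n g @` C) <= c
    & exists z : X * X, [/\ C z.1, C z.2 & d < mdist z.1 z.2]].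
  have /existsNP[C /not_implyP[conC /not_implyP[smallC largeC]]] := noM m.
  exists C; split=> //.
  - by move=> n /smallC[].
  - by move=> n /smallC[].
  apply: contrapT => /forallNP close; apply: largeC.
  apply: diam_le (ltW d0) _ => x y Cx Cy; rewrite leNgt; apply/negP => ltd.
  by apply: (close (x, y)).
have /choice[z Cz] m : exists z : X * X,
    [/\ C m z.1, C m z.2 & d < mdist z.1 z.2].
  by have [] := badC m.
have [p zp] := Fcvg (fst \o z); have [q zq] := Fcvg (snd \o z).
pose L := [set y : X |
  forall V, nbhs y V -> \forall n \near F, C n `&` V !=set0].
have Lp : L p.
  move=> V /zp FV; near=> n; exists (z n).1; split; first by have [] := Cz n.
  by near: n.
have Lq : L q.
  move=> V /zq FV; near=> n; exists (z n).2; split; first by have [] := Cz n.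
  by near: n.
have conL : connected L.
  by apply: sub_ultra_limit_connected => // n; have [] := badC n.
have LW : L `<=` Wloc f c p `&` Wloc g c p.
  move=> y Ly; split.
    apply: (ultra_limit_Wloc (C := C)) Ly => //; last exact: zp.
      by move=> m; have [] := Cz m.
    by move=> m; have [] := badC m.
  apply: (ultra_limit_Wloc (C := C)) Ly => //; last exact: zp.
    by move=> m; have [] := Cz m.
  by move=> m; have [] := badC m.
have qp : q = p.
  have := connected_component_max Lp LW conL Lq.
  by rewrite totd //; exact: LW.
have d20 : 0 < d / 2 by rewrite divr_gt0.
have Fp : \forall n \near F, mdist p (z n).1 < d / 2.
  exact: near_mdist_lt zp d20.
have Fq : \forall n \near F, mdist p (z n).2 < d / 2.
  by apply: near_mdist_lt d20; rewrite -qp; exact: zq.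
have [n [ltp ltq]] := filter_ex (filterI Fp Fq).
have [_ _] := Cz n.
have := metric_triangle (z n).1 p (z n).2.
by rewrite (metric_sym _ p); lra.
Unshelve. all: by end_near. Qed.

End CompactMetric.

(** The element [a] is the one at which the partial sums first reach [h], or the last element if
    they never do. *)
Lemma split_half_sums (R : realDomainType) (T : Type) (F : T -> R) (s : seq T)
    (h : R) :
    0 <= h -> s <> [::] ->
  exists s1 a s2, [/\ s = s1 ++ a :: s2, \sum_(x <- s1) F x <= h
    & s2 = [::] \/ h <= \sum_(x <- s1) F x + F a].
Proof.
elim: s h => [//|a s IHs] h h0 _.
have [hFa|Fah] := leP h (F a).
  by exists [::], a, s; split=> //; rewrite big_nil ?add0r //; right.
case: s IHs => [|b s] IHs.
  by exists [::], a, [::]; split; [|rewrite big_nil|left].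
have [|//|s1 [c [s2 [-> le1 le2]]]] := IHs (h - F a).
  by rewrite subr_ge0 ltW.
exists (a :: s1), c, s2; split=> //; rewrite big_cons.
  by rewrite -lerBrDl.
by case: le2 => [|le2]; [left|right; rewrite -addrA -lerBlDl].
Qed.

(** * Chains of consecutively intersecting subcontinua *)

Section Chains.
Variable X : topologicalType.
Implicit Types (p q r : X) (A B C : set X) (s : seq (set X)).

Fixpoint chain p q s : Prop :=
  if s is A :: s' then
    [/\ subcontinuum A, A p & exists2 r, A r & chain r q s']
  else p = q.

(** The singleton makes the hull of the empty chain a continuum; for a non-empty chain from [p] it
    is absorbed by the first link. *)
Definition hull p s := [set p] `|` \big[setU/set0]_(A <- s) A.

Lemma chain_cat p r s t :
  chain p r (s ++ t) <-> exists2 q, chain p q s & chain q r t.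
Proof.
elim: s p => [|A s IHs] p /=; first by split=> [?|[_ <-]//]; exists p.
split=> [[cA Ap [a Aa /IHs[q sq qt]]]|[q [cA Ap [a Aa sq]] qt]].
  by exists q => //; split=> //; exists a.
by split=> //; exists a => //; apply/IHs; exists q.
Qed.

Lemma chain1 p q A : subcontinuum A -> A p -> A q -> chain p q [:: A].
Proof. by move=> *; split=> //; exists q. Qed.

Lemma chain_rev p q s : chain p q s -> chain q p (rev s).
Proof.
elim: s p => [|A s IHs] p /=; first by move->.
move=> [cA Ap [r Ar rq]]; rewrite rev_cons -cats1; apply/chain_cat.
by exists r; [exact: IHs|exact: chain1].
Qed.

Lemma hull_cons p r A s : A p -> A r -> hull p (A :: s) = A `|` hull r s.
Proof.
move=> Ap Ar; have pA : [set p] `<=` A by move=> _ ->.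
have rA : [set r] `<=` A by move=> _ ->.
by rewrite /hull big_cons !setUA (setUidr pA) (setUidl rA).
Qed.

Lemma hull_end p q s : chain p q s -> hull p s q.
Proof.
elim: s p => [|A s IHs] p /=; first by move->; left.
by move=> [cA Ap [r Ar rq]]; rewrite (hull_cons s Ap Ar); right; exact: IHs.
Qed.

Lemma hull_cat p q s t : chain p q s ->
  hull p (s ++ t) = hull p s `|` hull q t.
Proof.
move=> /hull_end pq; have qp : [set q] `<=` hull p s by move=> _ ->.
by rewrite {2}/hull setUA (setUidl qp) /hull big_cat setUA.
Qed.

Lemma hull_rev p q s : chain p q s -> hull q (rev s) = hull p s.
Proof.
elim: s p => [|A s IHs] p /=; first by move->; rewrite /rev.
move=> [cA Ap [r Ar rq]].
rewrite (hull_cons s Ap Ar) rev_cons -cats1 -(IHs _ rq).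
rewrite (hull_cat _ (chain_rev rq)) setUC; congr (_ `|` _).
by rewrite /hull big_seq1; apply/setUidr => _ ->.
Qed.

Lemma subcontinuum1 p : subcontinuum [set p].
Proof. by split; [exists p|exact: compact_set1|exact: connected1]. Qed.

Lemma subcontinuumU A B : subcontinuum A -> subcontinuum B ->
  A `&` B !=set0 -> subcontinuum (A `|` B).
Proof.
move=> [[a Aa] cA conA] [_ cB conB] AB; split; first by exists a; left.
- exact: compactU.
- exact: connectedU.
Qed.

Lemma subcontinuum_hull p q s : chain p q s -> subcontinuum (hull p s).
Proof.
elim: s p => [|A s IHs] p /=.
  by move->; rewrite /hull big_nil setU0; exact: subcontinuum1.
move=> [cA Ap [r Ar rq]]; rewrite (hull_cons s Ap Ar).
by apply: subcontinuumU => //; [exact: IHs|exists r; split=> //; left].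
Qed.

End Chains.

(** * Words of maps and their action *)

Section Words.
Variables (X : Type) (T : bool -> X -> X).

(** The last letter acts first, so concatenation is composition and appending a letter precomposes
    with its map. *)
Definition act (w : seq bool) (x : X) := foldr T x w.

Lemma image_act_cat v w (C : set X) : act (v ++ w) @` C = act v @` (act w @` C).
Proof.
rewrite image_comp; congr (_ @` _); apply/funext => x /=.
by rewrite /act foldr_cat.
Qed.

Lemma act_nseq b n x : act (nseq n b) x = iter n (T b) x.
Proof. by elim: n => //= n ->. Qed.

End Words.

(** * Frink's construction: from [rho] to the subadditive [chain_dist] *)

Section ChainMetric.
Variables (R : realType) (X : metricType R) (T : bool -> X -> X).
Variables (eps theta : R).
Hypothesis compactX : compact [set: X].
Hypothesis contT : forall b, continuous (T b).
Hypothesis eps_gt0 : 0 < eps.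
Hypothesis theta01 : 0 < theta < 1.

Local Notation act := (act T).

Let theta_ge0 : 0 <= theta. Proof. by case/andP: theta01 => /ltW. Qed.
Let theta_le1 : theta <= 1. Proof. by case/andP: theta01 => _ /ltW. Qed.

Lemma continuous_act w : continuous (act w).
Proof.
elim: w => [|b w IHw] x /=; first exact: cvg_id.
by apply: (@continuous_comp _ _ _ (act w) (T b)); [exact: IHw|exact: contT].
Qed.

Lemma subcontinuum_act w C : subcontinuum C -> subcontinuum (act w @` C).
Proof. by apply: subcontinuum_image; exact: continuous_act. Qed.

(* [sup set0 = 0], so [rho] vanishes on the sets whose images all stay small. *)
Definition rho (C : set X) : R :=
  sup [set theta ^+ size w | w in [set w | eps < diam (act w @` C)]].

Lemma rho_lb w C : eps < diam (act w @` C) -> theta ^+ size w <= rho C.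
Proof.
move=> lew; apply: ub_le_sup; last by exists w.
by exists 1 => _ [v _ <-]; exact: exprn_ile1.
Qed.

Lemma rho_le C r : 0 <= r ->
  (forall w, eps < diam (act w @` C) -> theta ^+ size w <= r) -> rho C <= r.
Proof.
move=> r0 ler; rewrite /rho; set E := (X in sup X).
have [->|/set0P E0] := eqVneq E set0; first by rewrite sup0.
by apply: ge_sup => // _ [w lew <-]; exact: ler.
Qed.

Lemma rho_ge0 C : 0 <= rho C.
Proof.
have [[w big_w]|/forallNP now] := pselect (exists w, eps < diam (act w @` C)).
  by apply: le_trans (rho_lb big_w); exact: exprn_ge0.
suff E0 : [set w | eps < diam (act w @` C)] = set0.
  by rewrite /rho E0 image_set0 sup0.
by rewrite -subset0 => w /now.
Qed.

Lemma rho_le1 C : rho C <= 1.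
Proof. by apply: rho_le => // w _; exact: exprn_ile1. Qed.

Lemma rho_singleton p : rho [set p] = 0.
Proof.
apply/eqP; rewrite eq_le rho_ge0 andbT; apply: rho_le => // w.
rewrite image_set1 ltNge => /negP[]; apply: diam_le => [|_ _ -> ->].
  exact: ltW.
by rewrite mdistxx ltW.
Qed.

Lemma rho_small_diam k C : rho C < theta ^+ k ->
  forall w, (size w <= k)%N -> diam (act w @` C) <= eps.
Proof.
move=> ltrho w lew; rewrite leNgt; apply/negP => /rho_lb.
by apply/negP; rewrite -ltNge (lt_le_trans ltrho)// ler_wiXn2l.
Qed.

Lemma near_act_small k (e : R) : 0 < e ->
  exists2 d : R, 0 < d & forall x y, mdist x y < d ->
    forall w, (size w <= k)%N -> mdist (act w x) (act w y) < e.
Proof.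
move=> e0; elim: k => [|k [d d0 IHk]].
  by exists e => // x y xy [].
have unif b := compact_continuous_uniform compactX (@contT b) d0.
have [d1 d10 h1] := unif true; have [d2 d20 h2] := unif false.
exists (Num.min d (Num.min d1 d2)); first by rewrite !lt_min d0 d10.
move=> x y; rewrite !lt_min => /and3P[ltd ltd1 ltd2] w.
case/lastP: w => [_|w b]; first exact: (IHk _ _ ltd [::]).
rewrite size_rcons ltnS -cats1 /act !foldr_cat /= => lew.
by apply: IHk lew; case: b; [exact: h1|exact: h2].
Qed.

Variable m : nat.
Hypothesis unif_expansive : forall C, connected C ->
  (forall w, (size w <= m)%N -> diam (act w @` C) <= eps) -> diam C <= eps / 3.
Hypothesis theta_m : 2^-1 <= theta ^+ m.

(** If [w] makes the union larger than [eps], it makes one of the three sets larger than [eps / 3].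
    By uniform expansivity at most [m] further letters make that set larger than [eps], and they
    cost a factor [theta ^+ m], which is at least one half. *)
Lemma rho_quasi A B C r :
    subcontinuum A -> subcontinuum B -> subcontinuum C ->
    A `&` B !=set0 -> B `&` C !=set0 ->
    rho A <= r -> rho B <= r -> rho C <= r ->
  rho (A `|` B `|` C) <= 2 * r.
Proof.
move=> cA cB cC [a [Aa Ba]] [b [Bb Cb]] rA rB rC.
have r0 : 0 <= r by apply: le_trans rA; exact: rho_ge0.
apply: rho_le => [|w big_w]; first by rewrite mulr_ge0.
suff [S [v [lev rS big_v]]] : exists S v, [/\ (size v <= m)%N, rho S <= r
    & eps < diam (act v @` (act w @` S))].
  rewrite -image_act_cat in big_v.
  have := le_trans (rho_lb big_v) rS; rewrite size_cat exprD => levw.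
  have : theta ^+ m * theta ^+ size w <= r.
    by apply: le_trans levw; rewrite ler_wpM2r ?exprn_ge0// ler_wiXn2l.
  have : 2^-1 * theta ^+ size w <= theta ^+ m * theta ^+ size w.
    by rewrite ler_wpM2r ?exprn_ge0.
  by lra.
apply: contrapT => none.
have small S : subcontinuum S -> rho S <= r -> diam (act w @` S) <= eps / 3.
  move=> cS rS; apply: unif_expansive.
    by have [] := subcontinuum_act w cS.
  move=> v lev; rewrite leNgt; apply/negP => big_v.
  by apply: none; exists S, v.
(* Otherwise all three images have diameter at most [eps / 3]; passing through the middle set [B]
   bounds the diameter of the union by three times this. *)
have near_B x : (A `|` B `|` C) x ->
    exists2 y, B y & mdist (act w x) (act w y) <= eps / 3.
  move=> [[Ax|Bx]|Cx].
  - exists a => //; apply: le_trans (small _ cA rA).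
    by apply: mdist_le_diam.
  - by exists x => //; rewrite mdistxx divr_ge0// ltW.
  - exists b => //; apply: le_trans (small _ cC rC).
    by apply: mdist_le_diam.
move: big_w; rewrite ltNge => /negP; apply; apply: diam_le; first exact: ltW.
move=> _ _ [x /near_B[x' Bx' xx'] <-] [y /near_B[y' By' yy'] <-].
have : mdist (act w x') (act w y') <= eps / 3.
  apply: le_trans (small _ cB rB).
  by apply: mdist_le_diam.
have := metric_triangle (act w x) (act w x') (act w y).
have := metric_triangle (act w x') (act w y') (act w y).
by rewrite (metric_sym (act w y)) in yy'; lra.
Qed.

(* Frink's metrization argument: cutting the chain where the partial sums cross
   half of the total leaves two halves to which induction applies. *)
Lemma rho_chain p q s : chain p q s ->
  rho (hull p s) <= 2 * \sum_(A <- s) rho A.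
Proof.
have [n] := ubnP (size s); elim: n s p q => // n IHn s p q.
have [->|/eqP s0] := eqVneq s [::].
  by move=> _ _; rewrite /hull !big_nil setU0 rho_singleton mulr0.
set S := \sum_(A <- s) rho A => ltsn pq.
have S0 : 0 <= S by apply: sumr_ge0 => A _; exact: rho_ge0.
have [|s1 [A [s2 [Es le1 le2]]]] := @split_half_sums _ _ rho s (S / 2) _ s0.
  by rewrite divr_ge0.
move: pq ltsn; rewrite Es => /chain_cat[a pa [cA Aa [b Ab bq]]].
rewrite size_cat /= addnS ltnS => ltsn.
have ES : S = \sum_(A <- s1) rho A + (rho A + \sum_(A <- s2) rho A).
  by rewrite /S Es big_cat big_cons.
have pos t : 0 <= \sum_(A <- t) rho A by apply: sumr_ge0 => *; exact: rho_ge0.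
have le2' : \sum_(A <- s2) rho A <= S / 2.
  by case: le2 => [->|]; [rewrite big_nil divr_ge0|rewrite ES; lra].
have chain_As2 : chain a q (A :: s2) by split=> //; exists b.
rewrite (hull_cat _ pa) (hull_cons s2 Aa Ab) setUA.
(* Here [r] is [S]: each outer part of the chain has sum at most [S / 2], so its hull has [rho] at
   most [S] by induction, while [rho A] is a single term of the sum. *)
apply: rho_quasi => //.
- exact: subcontinuum_hull pa.
- exact: subcontinuum_hull bq.
- by exists a; split=> //; exact: hull_end.
- by exists b; split=> //; left.
- by apply: le_trans (IHn _ _ _ _ pa) _;
    [exact: leq_ltn_trans (leq_addr _ _) ltsn|lra].
- rewrite ES; have := pos s1; have := pos s2. lra.
- by apply: le_trans (IHn _ _ _ _ bq) _;
    [exact: leq_ltn_trans (leq_addl _ _) ltsn|lra].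
Qed.

Definition chain_dist (p q : X) (C : set X) : R :=
  inf [set \sum_(A <- s) rho A | s in [set s | chain p q s /\ hull p s = C]].

Lemma chain_dist_le (p q : X) s :
  chain p q s -> chain_dist p q (hull p s) <= \sum_(A <- s) rho A.
Proof.
move=> pq; apply: ge_inf; last by exists s.
by exists 0 => _ [t _ <-]; apply: sumr_ge0 => A _; exact: rho_ge0.
Qed.

Lemma chain_hull1 (p q : X) C : E_set (p, q, C) ->
  chain p q [:: C] /\ hull p [:: C] = C.
Proof.
move=> [/= cC Cp Cq]; split; first exact: chain1.
by rewrite /hull big_seq1; apply/setUidr => _ ->.
Qed.

(** The one-link chain [[:: C]] shows that the infimum is taken over a non-empty set. *)
Lemma chain_dist_lb (p q : X) C r : E_set (p, q, C) ->
  (forall s, chain p q s -> hull p s = C -> r <= \sum_(A <- s) rho A) ->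
  r <= chain_dist p q C.
Proof.
move=> EC ler; apply: lb_le_inf; last by move=> _ [s [pq sC] <-]; exact: ler.
by have [pq sC] := chain_hull1 EC; exists (rho C), [:: C] => //;
  rewrite big_seq1.
Qed.

Lemma chain_dist_le_rho (p q : X) C : E_set (p, q, C) ->
  chain_dist p q C <= rho C.
Proof.
move=> /chain_hull1[/chain_dist_le + sC].
by rewrite sC big_seq1.
Qed.

Lemma rho_le_chain_dist (p q : X) C : E_set (p, q, C) ->
  rho C <= 2 * chain_dist p q C.
Proof.
move=> EC; rewrite -ler_pdivrMl//; apply: chain_dist_lb => // s pq <-.
by rewrite ler_pdivrMl//; exact: rho_chain pq.
Qed.

Lemma chain_dist_sym p q C : chain_dist p q C = chain_dist q p C.
Proof.
rewrite /chain_dist; congr inf; apply/seteqP.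
split=> _ [s [pq sC] <-]; exists (rev s); first 1 last.
- by apply: perm_big; rewrite perm_rev.
- by split; [exact: chain_rev|rewrite (hull_rev pq)].
- by apply: perm_big; rewrite perm_rev.
- by split; [exact: chain_rev|rewrite (hull_rev pq)].
Qed.

(** Chains for [A] and for [B] concatenate to a chain for the union. *)
Lemma chain_dist_triangle (p q r : X) A B :
    E_set (p, q, A) -> E_set (q, r, B) ->
  chain_dist p r (A `|` B) <= chain_dist p q A + chain_dist q r B.
Proof.
move=> EA EB; rewrite -lerBlDr; apply: chain_dist_lb => // s pq sA.
rewrite lerBlDl -lerBlDr; apply: chain_dist_lb => // t qr tB.
rewrite lerBlDr addrC -big_cat -sA -tB -(hull_cat _ pq).
by apply: chain_dist_le; apply/chain_cat; exists q.
Qed.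

End ChainMetric.

(** * Estimates on powers and on self-similar real sequences *)

Section Powers.
Variable R : realType.

Lemma exprn_small (mu e : R) : 0 < mu < 1 -> 0 < e -> exists k, mu ^+ k <= e.
Proof.
move=> /andP[mu0 mu1] e0.
have cvg0 : (fun n => mu ^+ n) @ \oo --> (0 : R).
  by apply: cvg_expr; rewrite ger0_norm ?ltW.
have /cvgrPdist_le/(_ e e0) := cvg0.
move=> /filter_ex[k]; rewrite sub0r normrN ger0_norm.
  by exists k.
by rewrite exprn_ge0// ltW.
Qed.

Lemma bernoulli_inequality (x : R) n : 0 <= x <= 1 ->
  1 - n%:R * x <= (1 - x) ^+ n.
Proof.
move=> /andP[x0 x1]; elim: n => [|n IHn]; first by rewrite mul0r subr0.
have nx0 : 0 <= n%:R * x * x by rewrite !mulr_ge0.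
have : (1 - x) * (1 - n%:R * x) <= (1 - x) * (1 - x) ^+ n.
  by rewrite ler_wpM2l ?subr_ge0.
by rewrite exprS -natr1; lra.
Qed.

Lemma exprn_near1 m : exists2 mu : R, 0 < mu < 1 & 2^-1 <= (mu ^+ 2) ^+ m.
Proof.
(* Bernoulli bounds [(1 - x) ^+ (2 * m)] below by [1 - 2 * m * x], which is at least one half for
   this [x]. The successor keeps [x] positive when [m] is 0. *)
pose x : R := (4 * m.+1%:R)^-1.
have x0 : 0 < x by rewrite invr_gt0 mulr_gt0.
have mx : 4 * (m%:R * x) + 4 * x = 1.
  by rewrite -mulrDr -{2}(mul1r x) -mulrDl natr1 mulrA mulfV// mulf_neq0.
have mx0 : 0 <= m%:R * x by rewrite mulr_ge0// ltW.
exists (1 - x); first by apply/andP; split; lra.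
rewrite -exprM; apply: le_trans (bernoulli_inequality _ _); last first.
  by apply/andP; split; lra.
by rewrite natrM -mulrA; lra.
Qed.

(* A term exceeding [mu] times its predecessor forces growth by the factor
   [mu^-1] at every later step. *)
Lemma bounded_self_similar_seq (mu B : R) (a : nat -> R) : 0 < mu < 1 ->
    (forall j, 0 <= a j <= B) ->
    (forall j, Num.max (a j.+2) (a j) = mu^-1 * a j.+1) ->
  forall n, a n <= mu ^+ n * a 0%N.
Proof.
move=> mu01 aB rec; have /andP[mu0 mu1] := mu01.
have decr j : a j.+1 <= mu * a j.
  rewrite leNgt -ltr_pdivlMl//; apply/negP => grow.
  (* The strict inequality is carried along because it excludes the earlier term from the maximum in
     [rec], so the later term must realise it. *)
  have growth i : a (i + j).+1 = mu ^- i * a j.+1 /\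
      a (i + j)%N < mu^-1 * a (i + j).+1.
    elim: i => [|i [IH1 IH2]]; first by rewrite expr0 invr1 mul1r.
    rewrite !addSn; have := rec (i + j)%N.
    rewrite /Num.max; case: ifP => [_ E|_ E].
      by move: IH2; rewrite -E ltxx.
    have a1 : 0 < a (i + j).+1.
      have /andP[aj0 _] := aB (i + j)%N.
      by have := le_lt_trans aj0 IH2; rewrite pmulr_rgt0// invr_gt0.
    rewrite E; split; first by rewrite IH1 mulrA exprS invfM.
    rewrite mulrA ltr_pMl// -invfM invf_gt1 ?mulr_gt0//.
    by rewrite mulr_ilt1// ltW.
  have aj1 : 0 < a j.+1.
    have /andP[aj0 _] := aB j.
    by have := le_lt_trans aj0 grow; rewrite pmulr_rgt0// invr_gt0.
  have B0 : 0 < B by apply: lt_le_trans aj1 _; have /andP[] := aB j.+1.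
  (* After [k] steps of growth the bound [B] gives [a j.+1 <= mu ^+ k * B], which this [k] makes at
     most half of [a j.+1]. *)
  have [|k small_k] := @exprn_small mu (a j.+1 / (2 * B)) mu01.
    by rewrite divr_gt0// mulr_gt0.
  have [growk _] := growth k; have /andP[_] := aB (k + j).+1.
  rewrite growk ler_pdivrMl ?exprn_gt0// => le1.
  have : mu ^+ k * B <= a j.+1 / (2 * B) * B by rewrite ler_wpM2r// ltW.
  have -> : a j.+1 / (2 * B) * B = a j.+1 / 2 by field; rewrite gt_eqF.
  by lra.
elim=> [|n IHn]; first by rewrite mul1r.
apply: le_trans (decr n) _; rewrite exprS -mulrA ler_wpM2l//.
exact: ltW.
Qed.

End Powers.

(** * The weighted supremum [cw_dist], its self-similarity and its compatibility with the
    diameter *)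

Section SelfSimilarMetric.
Variables (R : realType) (X : metricType R) (T : bool -> X -> X).
Variables (eps mu : R) (m : nat).
Hypothesis compactX : compact [set: X].
Hypothesis contT : forall b, continuous (T b).
Hypothesis eps_gt0 : 0 < eps.
Hypothesis mu01 : 0 < mu < 1.
Hypothesis uniform : forall d : R, 0 < d -> exists k, forall C, connected C ->
  (forall w, (size w <= k)%N -> diam (act T w @` C) <= eps) -> diam C <= d.
Hypothesis uniform_third : forall C, connected C ->
  (forall w, (size w <= m)%N -> diam (act T w @` C) <= eps) ->
  diam C <= eps / 3.
Hypothesis mu_m : 2^-1 <= (mu ^+ 2) ^+ m.

Local Notation act := (act T).
Local Notation rho := (rho T eps (mu ^+ 2)).

Let theta01 : 0 < mu ^+ 2 < 1.
Proof.
have /andP[mu0 mu1] := mu01.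
by rewrite exprn_gt0//= exprn_ilt1// ltW.
Qed.

Let mu_ge0 : 0 <= mu. Proof. by case/andP: mu01 => /ltW. Qed.
Let mu_gt0 : 0 < mu. Proof. by case/andP: mu01. Qed.
Let mu_le1 : mu <= 1. Proof. by case/andP: mu01 => _ /ltW. Qed.

Definition base_dist (t : X * X * set X) : R :=
  chain_dist T eps (mu ^+ 2) t.1.1 t.1.2 t.2.

Definition cw_dist (t : X * X * set X) : R :=
  sup [set mu ^+ size w * base_dist (E_map (act w) t) | w in [set: seq bool]].

Lemma E_set_map (h : X -> X) t : continuous h -> E_set t -> E_set (E_map h t).
Proof.
move=> ch [cC Cp Cq]; split=> /=; first exact: subcontinuum_image.
- by exists t.1.1.
- by exists t.1.2.
Qed.

Lemma E_set_act w t : E_set t -> E_set (E_map (act w) t).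
Proof. by apply: E_set_map; exact: continuous_act. Qed.

Lemma E_map_comp (h k : X -> X) t : E_map h (E_map k t) = E_map (h \o k) t.
Proof. by rewrite /E_map /= image_comp. Qed.

Lemma E_map_act_rcons w b t :
  E_map (act w) (E_map (T b) t) = E_map (act (rcons w b)) t.
Proof.
rewrite E_map_comp; congr (E_map _ t); apply/funext => x.
by rewrite /act foldr_rcons.
Qed.

Lemma base_dist_ge0 t : E_set t -> 0 <= base_dist t.
Proof.
case: t => [[p q] C] Et; apply: chain_dist_lb => // s _ _.
by apply: sumr_ge0 => A _; exact: rho_ge0.
Qed.

Lemma base_dist_le_rho t : E_set t -> base_dist t <= rho t.2.
Proof. by case: t => [[p q] C]; exact: chain_dist_le_rho. Qed.

Lemma rho_le_base_dist t : E_set t -> rho t.2 <= 2 * base_dist t.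
Proof.
case: t => [[p q] C] Et.
exact: (rho_le_chain_dist compactX contT eps_gt0 theta01 uniform_third mu_m Et).
Qed.

Lemma base_dist_le1 t : E_set t -> base_dist t <= 1.
Proof.
move=> /base_dist_le_rho /le_trans; apply.
by apply: rho_le1; case/andP: theta01.
Qed.

Lemma cw_dist_lb w t : E_set t ->
  mu ^+ size w * base_dist (E_map (act w) t) <= cw_dist t.
Proof.
move=> Et; apply: ub_le_sup; last by exists w.
exists 1 => _ [v _ <-]; have Ev := E_set_act v Et.
by rewrite mulr_ile1 ?exprn_ge0 ?exprn_ile1 ?base_dist_ge0 ?base_dist_le1.
Qed.

Lemma cw_dist_le t r :
  (forall w, mu ^+ size w * base_dist (E_map (act w) t) <= r) -> cw_dist t <= r.
Proof.
move=> ler; apply: ge_sup => [|_ [w _ <-]//].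
by exists (mu ^+ size (Nil bool) * base_dist (E_map (act [::]) t)), [::].
Qed.

Lemma E_map_act0 t : E_map (act [::]) t = t.
Proof. by case: t => [[p q] C]; rewrite /E_map /= image_id. Qed.

Lemma base_dist_le_cw_dist t : E_set t -> base_dist t <= cw_dist t.
Proof. by move=> /(cw_dist_lb [::]); rewrite mul1r E_map_act0. Qed.

Lemma cw_dist_ge0 t : E_set t -> 0 <= cw_dist t.
Proof.
by move=> Et; apply: le_trans (base_dist_le_cw_dist Et); exact: base_dist_ge0.
Qed.

Lemma cw_dist_sym p q C : cw_dist (p, q, C) = cw_dist (q, p, C).
Proof.
congr sup; apply: eq_imagel => w _; congr (_ * _).
exact: chain_dist_sym.
Qed.

Lemma cw_dist_triangle p q r A B : E_set (p, q, A) -> E_set (q, r, B) ->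
  cw_dist (p, r, A `|` B) <= cw_dist (p, q, A) + cw_dist (q, r, B).
Proof.
move=> EA EB; apply: cw_dist_le => w.
apply: le_trans (lerD (cw_dist_lb w EA) (cw_dist_lb w EB)).
rewrite -mulrDr ler_wpM2l ?exprn_ge0// /base_dist /= image_setU.
by apply: (chain_dist_triangle T eps theta01);
  [exact: (E_set_act w EA)|exact: (E_set_act w EB)].
Qed.

(** If the distance vanishes then so does [rho C]; hence no image of [C] exceeds [eps], and uniform
    expansivity bounds [diam C] by every positive number. *)
Lemma cw_dist_eq0 p q C : E_set (p, q, C) ->
  cw_dist (p, q, C) = 0 <-> exists x, C = [set x].
Proof.
move=> EC; split=> [D0|[x Cx]]; last first.
  apply/eqP; rewrite eq_le cw_dist_ge0// andbT; apply: cw_dist_le => w.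
  apply: mulr_ge0_le0; first exact: exprn_ge0.
  apply: le_trans (base_dist_le_rho (E_set_act w EC)) _.
  by rewrite /= Cx image_set1 rho_singleton.
have rho0 : rho C <= 0.
  apply: le_trans (rho_le_base_dist EC) _; rewrite pmulr_rle0//.
  by rewrite -D0; exact: base_dist_le_cw_dist.
have diam0 : diam C <= 0.
  apply/ler_addgt0Pr => e e0; rewrite add0r; have [k smallk] := uniform e0.
  apply: smallk; first by case: EC => -[].
  apply: (rho_small_diam theta01); apply: le_lt_trans rho0 _.
  by rewrite exprn_gt0// exprn_gt0.
have [_ /= Cp _] := EC; exists p; apply/seteqP; split=> [x Cx|_ ->//].
apply: mdist_positivity; apply/eqP; rewrite eq_le mdist_ge0 andbT.
by apply: le_trans diam0; exact: mdist_le_diam.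
Qed.

(* A word realising half of [rho C] is long because [rho C] is small, hence
   expands [base_dist] by more than [mu^-1] per letter; so the empty word does
   not contribute to the supremum. *)
Lemma cw_dist_self_similar t : E_set t -> cw_dist t <= 32^-1 ->
  Num.max (cw_dist (E_map (T true) t)) (cw_dist (E_map (T false) t))
    = mu^-1 * cw_dist t.
Proof.
move=> Et small_t; set M := Num.max _ _.
have leM b : cw_dist (E_map (T b) t) <= M
  by rewrite /M le_max; case: b; rewrite lexx ?orbT.
have EbT b : E_set (E_map (T b) t) by exact: E_set_map.
have nonempty w b :
    mu ^+ size (rcons w b) * base_dist (E_map (act (rcons w b)) t) <= mu * M.
  rewrite size_rcons exprS -mulrA ler_wpM2l// -E_map_act_rcons.
  exact: le_trans (cw_dist_lb w (EbT b)) (leM b).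
apply/eqP; rewrite eq_le; apply/andP; split.
  rewrite ler_pdivlMl//; rewrite /M.
  have step b : mu * cw_dist (E_map (T b) t) <= cw_dist t.
    rewrite -ler_pdivlMl//; apply: cw_dist_le => w; rewrite ler_pdivlMl//.
    rewrite mulrA -exprS E_map_act_rcons -(size_rcons w b).
    exact: cw_dist_lb.
  by rewrite maxr_pMr// ge_max !step.
(* Only this inequality uses the smallness of [t], and only for the empty word. *)
rewrite ler_pdivrMl//; apply: cw_dist_le => w.
case/lastP: w => [|w b]; last exact: nonempty.
rewrite expr0 mul1r E_map_act0.
have M0 : 0 <= mu * M.
  by rewrite mulr_ge0// (le_trans (cw_dist_ge0 (EbT true)) (leM true)).
apply: le_trans (base_dist_le_rho Et) _.
have [rho0|rho_gt0] := leP (rho t.2) 0; first exact: le_trans M0.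
have [w [big_w half_w]] : exists w, eps < diam (act w @` t.2) /\
    rho t.2 / 2 < (mu ^+ 2) ^+ size w.
  apply: contrapT => /forallNP none.
  have : rho t.2 <= rho t.2 / 2.
    apply: rho_le => [|w big_w]; first by rewrite divr_ge0 // ltW.
    by rewrite leNgt; apply/negP => half; exact: (none w).
  by lra.
have rho_w := rho_lb theta01 big_w.
have rho_t := rho_le_base_dist Et.
have base_t := base_dist_le_cw_dist Et.
pose a := mu ^+ size w.
have aE : (mu ^+ 2) ^+ size w = a * a by rewrite -exprM mulnC exprM expr2.
have a0 : 0 < a by exact: exprn_gt0.
rewrite aE in half_w rho_w.
(* This is the source of the threshold: [a * a <= rho t.2 <= 2 * cw_dist t <= 16^-1]. In particular
   [w] is not empty. *)
have a4 : a <= 4^-1.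
  rewrite leNgt; apply/negP => lta.
  have : 4^-1 * 4^-1 < a * a by apply: ltr_pM.
  by lra.
(* The image under [w] is itself larger than [eps], so the empty word already gives it [rho] at
   least 1. *)
have base_w : 2^-1 <= base_dist (E_map (act w) t).
  have : 1 <= rho (act w @` t.2).
    by rewrite -(expr0 (mu ^+ 2)); apply: (@rho_lb _ _ _ _ _ theta01 [::]);
      rewrite image_id.
  by have := rho_le_base_dist (E_set_act w Et) => /=; lra.
have le_w : a * base_dist (E_map (act w) t) <= mu * M.
  case/lastP: w @a {big_w half_w rho_w aE a0 base_w} a4 => [|w b] a a4.
    by move: a4; rewrite /a expr0; lra.
  exact: nonempty.
(* By the choice of [w], [rho t.2 < 2 * (a * a)], and this is at most [a / 2] since [a <= 4^-1]. *)
apply: le_trans le_w; apply: (@le_trans _ _ (a * 2^-1)); last first.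
  by rewrite ler_wpM2l// ltW.
have : a * a <= a * 4^-1 by rewrite ler_wpM2l// ltW.
by lra.
Qed.

Lemma cw_dist_compatible : cw_metric_compatible cw_dist.
Proof.
move=> e e0; have e20 : 0 < e / 2 by rewrite divr_gt0.
have [k mu_k] := exprn_small mu01 e20.
(* Words [w] of length at least [k] contribute at most [mu ^+ k]. For shorter ones, [rho] of the
   image can only come from words [v] of length at least [k], because [v ++ w] would otherwise have
   length at most [k + k] and keep [C] small. *)
have [d d0 small_d] := near_act_small compactX contT (k + k) eps_gt0.
have [n diam_n] := uniform e20.
have theta_n : 0 < (mu ^+ 2) ^+ n / 2 by rewrite divr_gt0// !exprn_gt0.
(* The second bound is halved because [rho] is at most twice the distance; it keeps all images under
   words of length at most [n] below [eps]. *)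
exists (Num.min d ((mu ^+ 2) ^+ n / 2)); first by rewrite lt_min d0.
move=> C cC; split; last first.
  move=> [p [q [Cp Cq]]]; rewrite lt_min => /andP[_ Dn].
  have EC : E_set (p, q, C) by [].
  apply: (@le_lt_trans _ _ (e / 2)); last by lra.
  apply: diam_n; first by case: cC.
  apply: (rho_small_diam theta01).
  have := rho_le_base_dist EC; have := base_dist_le_cw_dist EC.
  by rewrite /=; lra.
rewrite lt_min => /andP[Cd _] p q Cp Cq.
have EC : E_set (p, q, C) by [].
apply: (@le_lt_trans _ _ (e / 2)); last by lra.
apply: le_trans mu_k; apply: cw_dist_le => w; have Ew := E_set_act w EC.
have [lekw|ltwk] := leqP k (size w).
  apply: (@le_trans _ _ (mu ^+ size w)); last by rewrite ler_wiXn2l.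
  by rewrite ler_piMr ?exprn_ge0 ?base_dist_le1.
apply: (@le_trans _ _ (rho (act w @` C))).
  apply: le_trans (base_dist_le_rho Ew).
  by rewrite ler_piMl ?base_dist_ge0 ?exprn_ile1.
apply: rho_le => [|v big_v]; first exact: exprn_ge0.
rewrite -exprM ler_wiXn2l//.
have [lekv|ltvk] := leqP k (size v).
  by rewrite mul2n -addnn (leq_trans lekv) ?leq_addr.
move: big_v; rewrite -image_act_cat ltNge => /negP[].
apply: diam_le; first exact: ltW.
move=> _ _ [x Cx <-] [y Cy <-]; apply/ltW/small_d.
  by apply: le_lt_trans Cd; exact: mdist_le_diam.
by rewrite size_cat leq_add// ltnW.
Qed.

Lemma cw_dist_axioms : cw_metric_axioms cw_dist.
Proof.
split=> [p q C EC|p q C _|A B p q r cA cB Ap [Aq Bq] Br].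
- by split; [exact: cw_dist_ge0|exact: cw_dist_eq0].
- exact: cw_dist_sym.
- by apply: cw_dist_triangle.
Qed.

End SelfSimilarMetric.

(** * Hyperbolicity deduced from self-similarity *)

Section Hyperbolicity.
Variables (R : realType) (X : metricType R) (D : X * X * set X -> R).
Variables (f g : X -> X) (mu xi e : R).
Hypothesis cf : continuous f.
Hypothesis fK : cancel f g.
Hypothesis mu01 : 0 < mu < 1.
Hypothesis D_ge0 : forall t, E_set t -> 0 <= D t.
Hypothesis small_D : forall p q C, E_set (p, q, C) -> diam C <= e ->
  D (p, q, C) <= xi.
Hypothesis D_similar : forall t, E_set t -> D t <= xi ->
  Num.max (D (E_map f t)) (D (E_map g t)) = mu^-1 * D t.

(** Stability keeps the whole forward orbit below [xi]. Since [g] undoes [f], self-similarity at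
    time [j.+1] relates the distances at times [j], [j.+1] and [j.+2], which is the recursion of
    [bounded_self_similar_seq]. *)
Lemma self_similar_contracts p q C n : E_set (p, q, C) -> Cstable f e C ->
  D (E_map (iter n f) (p, q, C)) <= mu ^+ n * D (p, q, C).
Proof.
move=> EC [_ stabC]; pose a n := D (E_map (iter n f) (p, q, C)).
have a0 : a 0%N = D (p, q, C) by rewrite /a /E_map /= image_id.
have Ea j : E_set (E_map (iter j f) (p, q, C)).
  by apply: E_set_map => //; exact: continuous_iter.
have a_le j : a j <= xi by apply: small_D; [exact: Ea|exact: stabC].
rewrite -a0; apply: (@bounded_self_similar_seq _ mu xi a) => // j.
  by rewrite a_le andbT; exact/D_ge0/Ea.
have := D_similar (Ea j.+1) (a_le j.+1); rewrite !E_map_comp => <-.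
congr Num.max; congr (D (E_map _ _)); apply/funext => x /=.
by rewrite fK.
Qed.

End Hyperbolicity.

Theorem theorem3p2 (R : realType) (X : metricType R) (f g : X -> X)
    (hX : peano_continuum X) (hf : homeomorphism f g) (hcw : cw_expansive f g) :
  exists D : X * X * set X -> R,
    hyperbolic_cw_metric f g D /\ self_similar f g D.
Proof.
have [compactX _ _] := hX; have [cf cg fK gK] := hf.
have [c c0 totd] := hcw.
pose T b := if b then f else g.
have contT b : continuous (T b) by case: b.
(* Smallness along all words includes the constant words, that is, the iterates of [f] and of
   [g]. *)
have uniform (d : R) : 0 < d -> exists k, forall C, connected C ->
    (forall w, (size w <= k)%N -> diam (act T w @` C) <= c) -> diam C <= d.
  move=> d0; have [k smallk] := cw_expansive_uniform compactX cf cg totd d0.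
  exists k => C conC diamC; apply: smallk => // n lenk.
  have iterE b : iter n (T b) = act T (nseq n b).
    by apply/funext => x; rewrite act_nseq.
  by have := (iterE true, iterE false) => /= -[-> ->];
    split; apply: diamC; rewrite size_nseq.
have [m uniform_third] := uniform (c / 3) (divr_gt0 c0 (ltr0n _ 3)).
have [mu mu01 mu_m] := exprn_near1 R m.
pose D := cw_dist T c mu.
have Dsim : forall t, E_set t -> D t <= 32^-1 ->
    Num.max (D (E_map f t)) (D (E_map g t)) = mu^-1 * D t.
  by move=> t Et Dt; rewrite -(cw_dist_self_similar compactX contT c0 mu01
    uniform_third mu_m Et Dt).
have compD : cw_metric_compatible D.
  exact: (cw_dist_compatible compactX contT c0 mu01 uniform
    uniform_third mu_m).
have axD : cw_metric_axioms D.
  exact: (cw_dist_axioms compactX contT c0 mu01 uniform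
    uniform_third mu_m).
have xi0 : 0 < 32^-1 :> R by [].
have D_ge0 t : E_set t -> 0 <= D t.
  by case: t => [[p q] C]; have [+ _ _] := axD => /[apply] -[].
exists D; split; last first.
  exists 32^-1, mu^-1; split=> //; first by rewrite invf_gt1; case/andP: mu01.
  by move=> p q C; exact: Dsim.
split=> //; have [d d0 smallD] := compD _ xi0.
(* Halving turns the strict bound on the diameter in compatibility into the non-strict one of
   [Cstable]. *)
have d20 : 0 < d / 2 by rewrite divr_gt0.
have smallD2 p q C : E_set (p, q, C) -> diam C <= d / 2 -> D (p, q, C) <= 32^-1.
  move=> [/= cC Cp Cq] leC; apply/ltW/(smallD C cC).1 => //.
  by apply: le_lt_trans leC _; lra.
(* Contraction is obtained with constant 1 and weakened to 4. *)
have relax p q C n x : E_set (p, q, C) -> x <= mu ^+ n * D (p, q, C) ->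
    x <= 4 * mu ^+ n * D (p, q, C).
  move=> EC /le_trans; apply; rewrite -mulrA ler_peMl ?ler1n//.
  by rewrite mulr_ge0 ?D_ge0 ?exprn_ge0 //; case/andP: mu01 => /ltW.
exists mu, (d / 2); split=> // p q C EC stabC n; apply: relax => //.
  exact: (self_similar_contracts cf fK mu01 D_ge0 smallD2 Dsim).
apply: (self_similar_contracts cg gK mu01 D_ge0 smallD2) => // t Et Dt.
by rewrite maxC; exact: Dsim.
Qed.
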